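(* There exist single-qubit states ($2\times2$ density matrices) $\varrho$ and $\tau$ such that $\Sigma(\tau)>\Sigma(\varrho)$, but no free operation $\Lambda$ satisfies $\Lambda(\varrho)=\tau$.
   Context: Let $\{|0\rangle,|1\rangle\}$ be the standard basis of $\mathbb{C}^2$, $|f_1\rangle=(|0\rangle+|1\rangle)/\sqrt2$ and $f_1=|f_1\rangle\langle f_1|$. A free operation is a completely positive trace-preserving linear map $\Lambda: M_2(\mathbb{C})\to M_2(\mathbb{C})$ with $\Lambda(f_1)=f_1$. The grand sum of a $2\times 2$ density matrix $\varrho$ is $\Sigma(\varrho)=\sum_{i,j}\varrho_{ij}=2\langle f_1|\varrho|f_1\rangle$, the sum of all its matrix entries in the standard basis. *)

(* Defs.v *)
From mathcomp Require Import all_boot all_order all_algebra.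
From mathcomp Require Import reals.
From mathcomp.real_closed Require Import complex mxtens.

Set Implicit Arguments.
Unset Strict Implicit.
Unset Printing Implicit Defensive.

Import Order.TTheory GRing.Theory Num.Theory.
Local Open Scope ring_scope.
Local Open Scope complex_scope.
Local Open Scope sesquilinear_scope.

(* The order of R[i] is partial: [0 <= z] means that z is real and nonnegative,
   and [x < y] forces x and y to have the same imaginary part. *)

Definition psdmx (R : realType) (n : nat) (A : 'M[R[i]]_n) : Prop :=
  A \is hermsymmx /\
  forall v : 'cV[R[i]]_n, 0 <= (v^t* *m A *m v) 0 0.

Definition density_matrix (R : realType) (n : nat) (rho : 'M[R[i]]_n) : Prop :=
  psdmx rho /\ \tr rho = 1.

(* id_k (x) L on M_k (x) M_m = M_(k * m), the identification being that of the
   Kronecker product: [mxtens_index (p, i)] is the basis vector e_p (x) e_i. *)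
Definition ampliation (R : realType) (k m n : nat)
    (L : 'M[R[i]]_m -> 'M[R[i]]_n) (X : 'M[R[i]]_(k * m)) : 'M[R[i]]_(k * n) :=
  \matrix_(r, s)
    L (\matrix_(i, j) X (mxtens_index ((mxtens_unindex r).1, i))
                        (mxtens_index ((mxtens_unindex s).1, j)))
      (mxtens_unindex r).2 (mxtens_unindex s).2.

Lemma ampliation_tens (R : realType) (k m n : nat)
    (L : {linear 'M[R[i]]_m -> 'M[R[i]]_n}) (A : 'M[R[i]]_k) (B : 'M[R[i]]_m) :
  ampliation L (A *t B) = A *t L B.
Proof.
apply/matrixP => r s; rewrite !mxE.
rewrite (_ : \matrix_(i, j) _ =
  A (mxtens_unindex r).1 (mxtens_unindex s).1 *: B) ?linearZ ?mxE //.
by apply/matrixP => i j; rewrite !mxE !mxtens_indexK.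
Qed.

Definition completely_positive (R : realType) (m n : nat)
    (L : 'M[R[i]]_m -> 'M[R[i]]_n) : Prop :=
  forall (k : nat) (X : 'M[R[i]]_(k * m)), psdmx X -> psdmx (ampliation L X).

Definition trace_preserving (R : realType) (m n : nat)
    (L : 'M[R[i]]_m -> 'M[R[i]]_n) : Prop :=
  forall X : 'M[R[i]]_m, \tr (L X) = \tr X.

Definition ket (R : realType) (i : 'I_2) : 'cV[R[i]]_2 := delta_mx i 0.

Definition ket_f1 (R : realType) : 'cV[R[i]]_2 :=
  (sqrtC 2)^-1 *: (ket R 0 + ket R 1).

Definition f1 (R : realType) : 'M[R[i]]_2 := ket_f1 R *m (ket_f1 R)^t*.

Definition free_operation (R : realType)
    (L : {linear 'M[R[i]]_2 -> 'M[R[i]]_2}) : Prop :=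
  [/\ completely_positive L, trace_preserving L & L (f1 R) = f1 R].

Definition grand_sum (R : realType) (rho : 'M[R[i]]_2) : R[i] :=
  \sum_i \sum_j rho i j.

Lemma grand_sumE (R : realType) (rho : 'M[R[i]]_2) :
  grand_sum rho = 2 * ((ket_f1 R)^t* *m rho *m ket_f1 R) 0 0.
Proof.
have s2 : (sqrtC 2 : R[i])^-1 * (sqrtC 2)^-1 = 2^-1.
  by rewrite -invfM -expr2 sqrtCK.
have k1 i : ket_f1 R i 0 = (sqrtC 2)^-1.
  rewrite !mxE eqxx !andbT.
  by case: i => [[|[|//]] Hi] /=; rewrite ?addr0 ?add0r mulr1.
have k2 i : (ket_f1 R)^t* 0 i = (sqrtC 2)^-1.
  rewrite mxE mxE k1; apply: conj_Creal.
  by rewrite ger0_real // invr_ge0 sqrtC_ge0 ler0n.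
rewrite mxE mulr_sumr /grand_sum exchange_big /=; apply: eq_bigr => j _.
rewrite mxE mulr_suml mulr_sumr; apply: eq_bigr => i _.
rewrite k1 k2 mulrAC s2 mulrA mulfV ?mul1r //.
by rewrite pnatr_eq0.
Qed.

(* Main.v *)
(** Mixing [f1] with the orthogonal state [f2] leaves a trace of [f1] in every
    image: [L (f1 / 4 + f2 * 3 / 4) = f1 / 4 + L f2 * 3 / 4] has a positive
    entry at [(1, 1)], because that entry of [f1] is [1 / 2] and that of
    [L f2] is nonnegative. The pure state [|0><0|], whose grand sum [1] exceeds
    the grand sum [1 / 2] of the mixture, vanishes there. *)
Require Import Defs.
From mathcomp Require Import all_boot all_order all_algebra.
From mathcomp Require Import reals.
From mathcomp.real_closed Require Import complex mxtens.
From mathcomp Require Import ring.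

Set Implicit Arguments.

Import Order.TTheory GRing.Theory Num.Theory.
Local Open Scope ring_scope.
Local Open Scope complex_scope.
Local Open Scope sesquilinear_scope.

(** The quadratic form at [v] is the squared norm of [A^t* *m v], a sum of terms [z * z^*]. *)
Lemma psdmx_mulmx_adjoint (R : realType) (n p : nat) (A : 'M[R[i]]_(n, p)) :
  psdmx (A *m A^t*).
Proof.
split.
  by apply/is_hermitianmxP; rewrite expr0 scale1r trmx_mul map_mxM trmxCK.
move=> v; rewrite mulmxA -mulmxA mxE sumr_ge0 // => k _.
suff -> : (v^t* *m A) 0 k = ((A^t* *m v) k 0)^*%R by rewrite mulrC mul_conjC_ge0.
rewrite !mxE rmorph_sum; apply: eq_bigr => j _.
by rewrite !mxE rmorphM /= conjCK mulrC.
Qed.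

Lemma psdmxD (R : realType) (n : nat) (A B : 'M[R[i]]_n) :
  psdmx A -> psdmx B -> psdmx (A + B).
Proof.
move=> [/is_hermitianmxP hA pA] [/is_hermitianmxP hB pB]; split.
  by apply/is_hermitianmxP; rewrite {1}hA {1}hB !expr0 !scale1r linearD map_mxD.
by move=> v; rewrite mulmxDr mulmxDl mxE addr_ge0.
Qed.

Lemma psdmxZ (R : realType) (n : nat) (c : R[i]) (A : 'M[R[i]]_n) :
  0 <= c -> psdmx A -> psdmx (c *: A).
Proof.
move=> c0 [/is_hermitianmxP hA pA]; split.
  apply/is_hermitianmxP; rewrite {1}hA !expr0 !scale1r linearZ /= map_mxZ.
  by rewrite /= conj_Creal // ger0_real.
by move=> v; rewrite -scalemxAr -scalemxAl mxE mulr_ge0.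
Qed.

Lemma psdmx_diag_ge0 (R : realType) (n : nat) (A : 'M[R[i]]_n) (j : 'I_n) :
  psdmx A -> 0 <= A j j.
Proof.
move=> [_ /(_ (delta_mx j 0))].
by rewrite trmx_delta map_delta_mx -rowE -colE !mxE.
Qed.

(** Complete positivity at [k = 1] is plain positivity, up to the index type [1 * m]. A Gram matrix
    remains one after tensoring with the [1 x 1] identity, so its positivity carries over to that
    type. *)
Lemma cp_mulmx_adjoint_diag_ge0 (R : realType) (m n p : nat)
    (L : {linear 'M[R[i]]_m -> 'M[R[i]]_n}) (A : 'M[R[i]]_(m, p)) (j : 'I_n) :
  completely_positive L -> 0 <= L (A *m A^t*) j j.
Proof.
move=> /(_ 1%N (1%:M *t (A *m A^t*))) cpL.
have psdX : psdmx (1%:M *t (A *m A^t*) : 'M[R[i]]_(1 * m)).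
  have -> : 1%:M *t (A *m A^t*) = (1%:M *t A) *m ((1%:M : 'M_1) *t A)^t*.
    by rewrite trmx_tens map_mxT tensmx_mul trmx1 map_mx1 mulmx1.
  exact: psdmx_mulmx_adjoint.
have /(psdmx_diag_ge0 (mxtens_index (0, j))) := cpL psdX.
by rewrite ampliation_tens !mxE !mxtens_indexK eqxx mul1r.
Qed.

Lemma conj_sqrtC2V (R : realType) : ((sqrtC 2)^-1 : R[i])^*%R = (sqrtC 2)^-1.
Proof. by rewrite conj_Creal // ger0_real // invr_ge0 sqrtC_ge0 ler0n. Qed.

Lemma f1E (R : realType) i j : f1 R i j = 2^-1.
Proof.
rewrite !mxE big_ord1 !mxE eqxx !andbT -!natrD.
(* Exactly one of the two basis kets contributes to each coordinate of [ket_f1]. *)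
have kE (k : 'I_2) : ((k == 0%R) + (k == 1%R) = 1)%N by case: k => [[|[]]].
by rewrite !kE mulr1 conj_sqrtC2V -invfM -expr2 sqrtCK.
Qed.

Lemma sum_ord2 (V : nmodType) (F : 'I_2 -> V) : \sum_k F k = F 0 + F 1.
Proof. by rewrite big_ord_recl big_ord1; congr (_ + F _); apply: val_inj. Qed.

(** The projector onto [(|0> - |1>) / sqrt 2], given by its entries so that no square root
    occurs. *)
Definition f2 (R : realType) : 'M[R[i]]_2 :=
  \matrix_(i, j) ((-1) ^+ (i != j) / 2).

(** An orthogonal projector is its own Gram factor, which makes the lemmas on [A *m A^t*] applicable
    to [f2]. *)
Lemma f2_idem (R : realType) : f2 R *m (f2 R)^t* = f2 R.
Proof.
apply/matrixP => i j; rewrite !mxE sum_ord2 !mxE.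
rewrite !rmorphM !rmorph_sign !fmorphV !rmorph_nat.
rewrite ![_ / 2 * (_ / 2)]mulrACA -mulrDl -!signr_addb.
(* With only two indices, the sign of each summand is independent of [k], so the two summands agree
   and add up. *)
have neqC (k : 'I_2) : (i != k) (+) (j != k) = (i != j).
  by case: i j k => [[|[|]]] // ? [[|[|]]] // ? [[|[|]]] // ?.
by rewrite !neqC; move: ((-1) ^+ _) => s; field.
Qed.

Lemma psdmx_f2 (R : realType) : psdmx (f2 R).
Proof. by rewrite -f2_idem; exact: psdmx_mulmx_adjoint. Qed.

Theorem proposition2 (R : realType) :
  exists rho tau : 'M[R[i]]_2,
    [/\ density_matrix rho,
        density_matrix tau,
        grand_sum rho < grand_sum tau
      & ~ exists L : {linear 'M[R[i]]_2 -> 'M[R[i]]_2},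
            free_operation L /\ L rho = tau].
Proof.
pose rho := 4^-1 *: f1 R + (3 / 4) *: f2 R.
pose tau := ket R 0 *m (ket R 0)^t*.
have tauE i j : tau i j = ((i == 0) && (j == 0))%:R.
  by rewrite /tau /ket trmx_delta map_delta_mx mul_delta_mx mxE.
(* The diagonal entries are [1 / 2] and the others [- 1 / 4], whence trace [1] and grand sum
   [1 / 2]. *)
have rhoE i j : rho i j = 8^-1 + (-1) ^+ (i != j) * (3 / 8).
  by rewrite mxE [X in X + _]mxE [X in _ + X]mxE f1E mxE; field.
have e01 : (0 == 1 :> 'I_2) = false by [].
have e10 : (1 == 0 :> 'I_2) = false by [].
exists rho, tau; split.
- split; last by rewrite /mxtrace sum_ord2 !rhoE !eqxx expr0; field.
  apply: psdmxD; apply: psdmxZ; rewrite ?divr_ge0 ?invr_ge0 ?ler0n //.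
    exact: psdmx_mulmx_adjoint.
  exact: psdmx_f2.
- split; first exact: psdmx_mulmx_adjoint.
  by rewrite /mxtrace sum_ord2 !tauE !eqxx e10 addr0.
- have -> : grand_sum rho = 2^-1.
    by rewrite /grand_sum !sum_ord2 !rhoE !eqxx e01 e10 expr0 expr1; field.
  have -> : grand_sum tau = 1.
    by rewrite /grand_sum !sum_ord2 !tauE !eqxx e10 !addr0.
  by rewrite invf_lt1 ?ltr0n ?ltr1n.
move=> [L [[cpL _ Lf1] /matrixP /(_ 1 1)]].
rewrite tauE e10 linearD !linearZ_LR Lf1 mxE [X in X + _]mxE [X in _ + X]mxE f1E.
apply/eqP; rewrite gt_eqF // ltr_pwDl ?mulr_gt0 ?invr_gt0 ?ltr0n //.
by rewrite mulr_ge0 ?divr_ge0 ?ler0n // -f2_idem cp_mulmx_adjoint_diag_ge0.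
Qed.
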